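(* The communication complexity of constructing a $+k$-spanner of an unweighted undirected distributed graph on $n$ vertices with edges observed at $s$ sites in the blackboard model with duplication is $\Omega(s+n^{4/3-o(1)}\log s)$.
   Context: Distributed graph: there are $s$ sites $S_1,\dots,S_s$ with a common vertex set $V$, $|V|=n$; site $S_i$ holds a subset $E_i\subseteq E$ of the edges of an undirected graph $G=(V,E)$, where $E=\bigcup_{i=1}^s E_i$. With duplication, the sets $E_i$ may have non-empty intersections. Blackboard model: sites communicate with each other through a shared blackboard (such as a broadcast channel), whose contents are visible to all; a coordinator outputs the result. The communication cost is the total number of bits communicated; the communication complexity of a problem is the communication cost needed to solve it. Spanner: a $+k$-spanner of $G$ (with $k$ the additive distance surplus) is a subgraph $H=(V,E')$, $E'\subseteq E$, with $d_H(u,v)\le d_G(u,v)+k$ for all $u,v\in V$, where $d$ denotes shortest-path distance. *)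

(* Defs.v *)
From mathcomp Require Import all_boot all_order all_algebra.
From mathcomp Require Import all_classical all_reals all_analysis.

Set Implicit Arguments.
Unset Strict Implicit.
Unset Printing Implicit Defensive.

Import Order.TTheory GRing.Theory Num.Theory.
Import numFieldNormedType.Exports.

Local Open Scope classical_set_scope.
Local Open Scope ring_scope.

(* An edge is a two-element set of vertices, so every set of edges is the edge
   set of a simple undirected graph on the vertex set 'I_n. *)
Definition edge (n : nat) : finType := {e : {set 'I_n} | #|e| == 2%N}.

Definition graph (n : nat) : finType := {set edge n}.

Definition adj (n : nat) (G : graph n) : rel 'I_n :=
  fun u v => [exists e in G, val e == [set u; v]%SET].

(* If there is no path, the infimum is over the empty set and equals +oo. *)
Definition dist (R : realType) (n : nat) (G : graph n) (u v : 'I_n) : \bar R :=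
  ereal_inf [set ((size p)%:R : R)%:E |
             p in [set p : seq 'I_n | path (adj G) u p && (last u p == v)]].

Definition is_spanner (R : realType) (n k : nat) (G H : graph n) : Prop :=
  H \subset G /\
  forall u v : 'I_n, (dist R H u v <= dist R G u v + (k%:R : R)%:E)%E.

(* Deterministic blackboard protocols with s sites, each holding an input in X.
   A node of the tree is a state of the blackboard: who writes next, and the
   result, depend on the blackboard only, while the bit written depends on the
   writer's own input and on the blackboard. *)
Inductive protocol (s : nat) (X O : Type) : Type :=
| Output of O
| Write of 'I_s & (X -> bool) & (bool -> protocol s X O).

Fixpoint run (s : nat) (X O : Type) (p : protocol s X O) (x : 'I_s -> X) : O :=
  match p with
  | Output o => o
  | Write i f q => run (q (f (x i))) x
  end.

Fixpoint bits (s : nat) (X O : Type) (p : protocol s X O) (x : 'I_s -> X) :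
    nat :=
  match p with
  | Output _ => 0%N
  | Write i f q => (bits (q (f (x i))) x).+1
  end.

(* Public-coin protocols.  A protocol of bounded cost involves only finitely
   many deterministic protocols up to equivalence, so a finite probability
   space of coins is no restriction. *)
Record rprotocol (R : realType) (s : nat) (X O : Type) := RProtocol {
  coins : nat;
  prob : 'I_coins -> R;
  prob_ge0 : forall w, 0 <= prob w;
  prob_sum1 : \sum_(w < coins) prob w = 1;
  strategy : 'I_coins -> protocol s X O
}.

Definition cost (R : realType) (s : nat) (X : finType) (O : Type)
    (P : rprotocol R s X O) : nat :=
  \max_(w < coins P) \max_(x : {ffun 'I_s -> X}) bits (strategy w) x.

Definition success (R : realType) (s : nat) (X O : Type)
    (P : rprotocol R s X O) (x : 'I_s -> X) (good : O -> Prop) : R :=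
  \sum_(w < coins P | `[< good (run (strategy w) x) >]) prob w.

Definition solves (R : realType) (s : nat) (X O : Type)
    (problem : ('I_s -> X) -> O -> Prop) (P : rprotocol R s X O) : Prop :=
  forall x : 'I_s -> X, 2 / 3 <= success P x (problem x).

Definition comm_complexity (R : realType) (s : nat) (X : finType) (O : Type)
    (problem : ('I_s -> X) -> O -> Prop) : \bar R :=
  ereal_inf [set ((cost P)%:R : R)%:E |
             P in [set P : rprotocol R s X O | solves problem P]].

(* The E_ i are arbitrary, in particular they may overlap (duplication). *)
Definition spanner_problem (R : realType) (k n s : nat)
    (E_ : 'I_s -> graph n) (H : graph n) : Prop :=
  is_spanner R k (\bigcup_(i < s) E_ i)%SET H.

Definition spanner_complexity (R : realType) (k n s : nat) : \bar R :=
  comm_complexity R (@spanner_problem R k n s).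

(* Main.v *)
(** Two bounds on the cost C are combined.  On the all-empty input each site must
    speak with probability at least 1/3, since a silent site could as well hold
    an edge; hence s <= 3 C.  Independently of s, there is a family of
    2^(n^(4/3 - o(1))) graphs, each determined by any one of its +k-spanners;
    handing the same graph to all sites, a protocol of cost C has at most 2^C
    outputs per coin, so C >= n^(4/3 - o(1)).  The factor log s is free: if
    s >= n^2 then n^(4/3) log s = O(s), and otherwise log s = O(log n) is
    absorbed by the o(1).

    The family is an obstacle product in the style of Abboud and Bodwin.  The
    outer graph has 2k+2 transitions, which alternately translate the two
    coordinates of a point of G * G by vectors alpha t, where alpha parametrizes
    the paraboloid { (t, |t|^2) }.  By strict convexity a route repeating t = a
    in the first coordinate and t = b in the second is the only outer walk between
    its ends, and any two consecutive transitions determine the route.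
    Transitions are subdivided into chains of k+1 edges and an outer vertex
    becomes a biclique between the arriving and the leaving chains, whose edges
    are thus labelled by routes; a member of the family keeps the edges with
    labels in a set S.  A walk of surplus at most k cannot go back through a
    whole chain, and each of the 2k+1 biclique edges of a route that it avoids
    costs it two extra steps; hence a spanner retains a biclique edge of each
    route in S, and so determines S. *)

From HB Require Import structures.
Require Import Defs.
From mathcomp Require Import all_boot all_order all_algebra.
From mathcomp Require Import all_classical all_reals all_analysis.
From mathcomp Require Import zify ring lra.
Import Order.TTheory GRing.Theory Num.Theory.
Import numFieldNormedType.Exports.
Local Open Scope classical_set_scope.
Local Open Scope ring_scope.

Set Implicit Arguments.
Unset Strict Implicit.
Unset Printing Implicit Defensive.

(** * The layered graph *)

Section LayeredGraph.
Variables (G : finZmodType) (T : finType) (alpha : T -> G) (k : nat).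

(* A route: its starting point and its two directions. *)
Definition label : Type := G * G * T * T.

(* (j, v, t, w) is the w-th vertex on the chain that replaces the transition in
   direction t out of the point v of level j. *)
Definition vertex : Type := 'I_k.+1.*2 * (G * G) * T * 'I_k.+2.

Definition shift (j : nat) (t : T) : G * G :=
  if odd j then (0, alpha t) else (alpha t, 0).

Definition route_point (v : G * G) (a b : T) (j : nat) : G * G :=
  v + (alpha a *+ uphalf j, alpha b *+ j./2).

(* The only route going through v at level j with consecutive directions t, t'. *)
Definition joint_label (j : nat) (v : G * G) (t t' : T) : label :=
  let: (a, b) := if odd j then (t', t) else (t, t') in
  (v - (alpha a *+ uphalf j, alpha b *+ j./2), a, b).

Definition level (x : vertex) : nat := x.1.1.1.
Definition base (x : vertex) : G * G := x.1.1.2.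
Definition dir (x : vertex) : T := x.1.2.
Definition pos (x : vertex) : nat := x.2.
Definition height (x : vertex) : nat := (level x * k.+2 + pos x)%N.

(** The biclique edges: from the end of a chain arriving at an outer vertex to the start of a chain
    leaving it. *)
Definition joint (x y : vertex) : bool :=
  [&& pos x == k.+1, pos y == 0%N, level y == (level x).+1 &
      base y == base x + shift (level x) (dir x)].

Definition vlabel (x y : vertex) : label :=
  joint_label (level x) (base x) (dir x) (dir y).

Definition inchain (x y : vertex) : bool :=
  [&& level y == level x, base y == base x, dir y == dir x & pos y == (pos x).+1].

Definition up (S : pred label) (x y : vertex) : bool :=
  inchain x y || joint x y && S (vlabel x y).

Lemma up_height S x y : up S x y -> height y = (height x).+1.
Proof.
rewrite /up /height /inchain /joint => /orP[|/andP[]].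
  by case/and4P=> /eqP-> _ _ /eqP->; rewrite addnS.
by case/and4P=> /eqP-> /eqP-> /eqP-> _ _; lia.
Qed.

(** * Walks that avoid the biclique edges of one route *)

Section Walk.
Variables (v0 : G * G) (a b : T).

(* Outer walks are recorded as the list of their directions, the last one first. *)
Fixpoint walk_end (ts : seq T) : G * G :=
  if ts is t :: ts' then walk_end ts' + shift (size ts') t else v0.

(* The number of biclique edges of the route (v0, a, b) that the straight walk
   along ts would use. *)
Fixpoint critical (ts : seq T) : nat :=
  if ts is t' :: ts' then
    if ts' is t :: ts'' then
      (joint_label (size ts'') (walk_end ts'') t t' == (v0, a, b)) + critical ts'
    else 0%N
  else 0%N.

Lemma critical_cons t ts : (critical ts <= critical (t :: ts) <= (critical ts).+1)%N.
Proof. by case: ts => [|t' ts] //=; case: eqP => _; lia. Qed.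

(* State of a walk with c downward steps so far: it is either on a chain leaving the
   end of the outer walk ts, or has backed up, by less than a chain, on some chain
   arriving there.  Avoiding a critical edge requires the second state, which is
   entered by a downward step; hence the bounds on critical. *)
Definition forward_state (x : vertex) (c : nat) : Prop :=
  exists ts : seq T, [/\ level x = size ts, base x = walk_end ts &
    (critical (dir x :: ts) <= c)%N].

Definition backward_state (x : vertex) (c : nat) : Prop :=
  exists ts : seq T, [/\ (level x).+1 = size ts,
    base x + shift (level x) (dir x) = walk_end ts,
    (k.+1 <= pos x + c)%N & (critical ts < c)%N].

Definition reached (x : vertex) (c : nat) : Prop :=
  [\/ (k.+1 <= c)%N, forward_state x c | backward_state x c].

Let avoids (x y : vertex) := up (predC1 (v0, a, b)) x y.

(** Crossing a biclique edge in the forward state adds no critical edge, since its label differs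
    from [(v0, a, b)]. In the backward state the new direction may add one, which the strict bound
    there pays for. *)
Lemma reached_up x y c : avoids x y -> reached x c -> reached y c.
Proof.
move=> xy [kc|[ts [lx bx cx]]|[ts [lx bx px cx]]]; first by constructor 1.
- constructor 2; case/orP: xy => [/and4P[/eqP ly /eqP base_y /eqP dy _]|].
    by exists ts; rewrite ly base_y dy.
  case/andP=> /and4P[_ _ /eqP ly /eqP base_y] /= /negPf nl.
  exists (dir x :: ts); split; first by rewrite ly lx.
    by rewrite base_y bx lx.
  by move: nl; rewrite /= /vlabel lx bx => ->.
- case/orP: xy => [/and4P[/eqP ly /eqP base_y /eqP dy /eqP py]|].
    by constructor 3; exists ts; rewrite ly base_y dy py; split => //; lia.
  case/andP=> /and4P[_ _ /eqP ly /eqP base_y] _.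
  constructor 2; exists ts; split; rewrite ?ly ?base_y //.
  by have /andP[_] := critical_cons (dir y) ts; lia.
Qed.

(** Descending over a biclique edge enters the backward state at the top of a chain, and this step
    makes the bound on [critical] strict. Descending out of a chain means [pos x = 0], hence
    [k.+1 <= c]. *)
Lemma reached_down x y c : avoids y x -> reached x c -> reached y c.+1.
Proof.
move=> xy [kc|[ts [lx bx cx]]|[ts [lx bx px cx]]]; first by constructor 1; lia.
- case/orP: xy => [/and4P[/eqP ly /eqP base_y /eqP dy _]|].
    constructor 2; exists ts; rewrite -ly -base_y -dy; split => //; lia.
  case/andP=> /and4P[/eqP py _ /eqP ly /eqP base_y] _.
  constructor 3; exists ts; rewrite -ly -base_y py; split => //; first lia.
  by have /andP[+ _] := critical_cons (dir x) ts; lia.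
- case/orP: xy => [/and4P[/eqP ly /eqP base_y /eqP dy /eqP py]|].
    by constructor 3; exists ts; rewrite -ly -base_y -dy; split => //; lia.
  case/andP=> /and4P[_ /eqP px0 _ _] _.
  by constructor 1; move: px; rewrite px0; lia.
Qed.

(** A downward step lengthens the walk and lowers the height, so it counts twice. *)
Lemma reached_path x p c :
  path (fun x y => avoids x y || avoids y x) x p -> reached x c ->
  exists c', reached (last x p) c' /\
    (height (last x p) + c'.*2 = height x + c.*2 + size p)%N.
Proof.
elim: p x c => [|y p IH] x c /=; first by exists c; split => //; lia.
case/andP=> xy /IH {}IH rx; have [xy'|yx] := orP xy.
  have [c' [rc' hc']] := IH _ (reached_up xy' rx).
  by exists c'; split; rewrite ?hc' ?(up_height xy')//; lia.
have [c' [rc' hc']] := IH _ (reached_down yx rx).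
by exists c'; split; rewrite ?hc' ?(up_height yx)//; lia.
Qed.

(** As the last direction comes first, the level of [t] is the size of the tail. Even levels move
    the first coordinate, odd ones the second. *)
Fixpoint evens (ts : seq T) : seq T :=
  if ts is t :: ts' then if odd (size ts') then evens ts' else t :: evens ts'
  else [::].
Fixpoint odds (ts : seq T) : seq T :=
  if ts is t :: ts' then if odd (size ts') then t :: odds ts' else odds ts'
  else [::].

Lemma size_evens ts : size (evens ts) = uphalf (size ts).
Proof. by elim: ts => //= t ts IH; case: ifP => /=; lia. Qed.

Lemma size_odds ts : size (odds ts) = (size ts)./2.
Proof. by elim: ts => //= t ts IH; case: ifP => /=; lia. Qed.

Lemma walk_endE ts : walk_end ts =
  v0 + (\sum_(t <- evens ts) alpha t, \sum_(t <- odds ts) alpha t).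
Proof.
elim: ts => [|t ts IH] /=; first by
  rewrite !big_nil; case: v0 => x y; congr pair; rewrite /= addr0.
rewrite IH /shift; case: ifP => _; rewrite !big_cons -addrA; congr (_ + _);
 by congr pair; rewrite /= ?addr0 // addrC.
Qed.

Lemma sum_const_seq (c : T) ts :
  all (pred1 c) ts -> \sum_(t <- ts) alpha t = alpha c *+ size ts.
Proof.
by move/all_pred1P=> ->; rewrite size_nseq big_nseq -Monoid.iteropE.
Qed.

Lemma critical_straight ts :
  all (pred1 a) (evens ts) -> all (pred1 b) (odds ts) ->
  critical ts = (size ts).-1.
Proof.
have E us : all (pred1 a) (evens us) -> all (pred1 b) (odds us) ->
    walk_end us = v0 + (alpha a *+ uphalf (size us), alpha b *+ (size us)./2).
  by move=> ha hb; rewrite walk_endE (sum_const_seq ha) (sum_const_seq hb)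
    size_evens size_odds.
elim: ts => [|t' [|t ts] IH] // ha hb.
have {}IH : critical (t :: ts) = size ts.
  apply: IH; [move: ha | move: hb]; move: (t :: ts) => us /=;
  by case: ifP => //= _ /andP[].
rewrite [LHS]/= -/(critical (t :: ts)) IH /=.
suff -> : joint_label (size ts) (walk_end ts) t t' = (v0, a, b) by rewrite eqxx.
move: ha hb; rewrite /joint_label /=; case: (odd (size ts)) => /=.
  by case/andP=> /eqP-> ha /andP[/eqP-> hb]; rewrite E // addrK.
by case/andP=> /eqP-> ha /andP[/eqP-> hb]; rewrite E // addrK.
Qed.

Hypothesis alpha_convex : forall (t : T) ts, size ts = k.+1 ->
  \sum_(u <- ts) alpha u = alpha t *+ k.+1 -> all (pred1 t) ts.

(** The two coordinates decouple, and convexity forces a constant direction in each. *)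
Lemma critical_closed ts : size ts = k.+1.*2 ->
  walk_end ts = v0 + (alpha a *+ k.+1, alpha b *+ k.+1) ->
  critical ts = (size ts).-1.
Proof.
move=> hs; rewrite walk_endE => /addrI[ha hb]; apply: critical_straight.
  by apply: alpha_convex ha; rewrite size_evens hs uphalf_double.
by apply: alpha_convex hb; rewrite size_odds hs doubleK.
Qed.

(** * The route as a path, and the walks competing with it *)

Lemma route_point_shift j : route_point v0 a b j.+1 =
  route_point v0 a b j + shift j (if odd j then b else a).
Proof.
rewrite /route_point /shift -addrA; congr (_ + _) => /=; rewrite uphalf_half.
by case: (odd j); congr pair; rewrite /= ?addr0 ?add1n ?add0n // mulrS addrC.
Qed.

(** A chain has [k.+2] vertices. Since [inord] falls back to 0 out of range, only indices up to
    [route_length] are meaningful. *)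
Definition route (i : nat) : vertex :=
  let j := (i %/ k.+2)%N in
  (inord j : 'I_(k.*2.+1).+1, route_point v0 a b j,
   if odd j then b else a, inord (i %% k.+2)).

Definition route_length : nat := (k.+1.*2 * k.+2).-1.

Lemma route_level i : (i <= route_length)%N -> level (route i) = (i %/ k.+2)%N.
Proof.
rewrite /route_length /level /= => hi; rewrite inordK //.
by rewrite ltn_divLR //; move: hi; rewrite doubleS; nia.
Qed.

Lemma route_pos i : pos (route i) = (i %% k.+2)%N.
Proof. by rewrite /pos /= inordK // ltn_mod. Qed.

Lemma route_up (S : pred label) i : S (v0, a, b) -> (i < route_length)%N ->
  up S (route i) (route i.+1).
Proof.
move=> Sl hi; rewrite /up /inchain /joint /vlabel !route_pos !route_level //; last exact: ltnW.
rewrite /base /dir /=; have := divn_eq i k.+2; have := ltn_pmod i (ltn0Sn k.+1).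
move: (i %/ k.+2)%N (i %% k.+2)%N => q r; rewrite ltnS leq_eqVlt.
(* At remainder [k.+1] a chain ends and the next edge belongs to a biclique. *)
move=> /orP[/eqP->|lt_r] eq_i.
  have eq_iS : i.+1 = (q.+1 * k.+2)%N by lia.
  rewrite eq_iS mulnK // modnMl eqxx !route_point_shift /= eqxx /=.
  apply/orP; right; rewrite /joint_label -/(route_point v0 a b q) /route_point.
  by case: (odd q) => /=; rewrite addrK eqxx.
have eq_iS : i.+1 = (q * k.+2 + r.+1)%N by lia.
by rewrite eq_iS divnMDl // modnMDl divn_small ?modn_small // addn0 !eqxx.
Qed.

(** Otherwise the number [c] of downward steps satisfies [c.*2 <= k], whereas an outer walk between
    the ends of the route has 2k+1 critical edges, and avoiding them requires at least that many
    downward steps. *)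
Lemma avoid_long_path p :
  path (fun x y => avoids x y || avoids y x) (route 0) p ->
  last (route 0) p = route route_length -> (route_length + k < size p)%N.
Proof.
move=> hp hl; rewrite ltnNge; apply/negP => hsz.
have lev_last : level (route route_length) = k.*2.+1.
  rewrite route_level // /route_length doubleS.
  have -> : (k.*2.+2 * k.+2).-1 = (k.*2.+1 * k.+2 + k.+1)%N by lia.
  by rewrite divnMDl // divn_small // addn0.
have pos_last : pos (route route_length) = k.+1.
  rewrite route_pos /route_length doubleS.
  have -> : (k.*2.+2 * k.+2).-1 = (k.*2.+1 * k.+2 + k.+1)%N by lia.
  by rewrite modnMDl modn_small.
have end_last : base (route route_length) +
    shift (level (route route_length)) (dir (route route_length)) =
    v0 + (alpha a *+ k.+1, alpha b *+ k.+1).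
  have lev : (route_length %/ k.+2)%N = k.*2.+1 by rewrite -lev_last route_level.
  rewrite lev_last /base /dir /= lev -route_point_shift /route_point.
  by rewrite -doubleS uphalf_double doubleK.
have hstart : reached (route 0) 0.
  constructor 2; exists [::]; split=> //=; first by rewrite route_level // div0n.
  by rewrite /base /= div0n /route_point /= !mulr0n addr0.
have [c []] := reached_path hp hstart; rewrite hl.
have -> : height (route 0) = 0%N.
  by rewrite /height route_level // route_pos div0n mod0n.
have -> : height (route route_length) = route_length.
  by rewrite /height lev_last pos_last /route_length doubleS; lia.
move=> rc hc; have {hc} hc : (c.*2 <= k)%N by lia.
suff [ts [hts ets cts]] : exists ts, [/\ size ts = k.+1.*2,
    walk_end ts = v0 + (alpha a *+ k.+1, alpha b *+ k.+1) & (critical ts <= c)%N].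
  by move: cts; rewrite critical_closed // hts; lia.
(* In the forward state the final direction is still missing from [ts]; in the backward state it is
   already there. *)
case: rc => [kc|[ts [lx bx cx]]|[ts [lx bx px cx]]]; first by lia.
  exists (dir (route route_length) :: ts); split => //.
    by rewrite /= -lx lev_last doubleS.
  by rewrite [LHS]/= -lx -bx end_last.
by exists ts; rewrite -lx lev_last doubleS -bx end_last; split => //; exact: ltnW.
Qed.

End Walk.

(** * Decoding the label set from a spanner *)

Section Embedding.
Variables (n : nat) (f : vertex -> 'I_n).
Hypothesis f_inj : injective f.

Definition hard_graph (S : {set label}) : graph n :=
  [set e : edge n | [exists x, exists y,
     up (mem S) x y && (val e == [set f x; f y]%SET)]]%SET.

Definition decode (H : graph n) : {set label} :=
  [set l | [exists x, exists y,
     [&& joint x y, vlabel x y == l & adj H (f x) (f y)]]]%SET.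

Lemma adj_hard_graphP (S : {set label}) u v : adj (hard_graph S) u v ->
  exists x y, [/\ u = f x, v = f y & up (mem S) x y || up (mem S) y x].
Proof.
case/existsP=> e /andP[]; rewrite inE => /existsP[x /existsP[y /andP[xy /eqP->]]].
move=> /eqP/setP E; have := E u; have := E v; have := E (f x); have := E (f y).
rewrite !inE !eqxx ?orbT /= => /esym Ey /esym Ex /orP[]/eqP Ev /orP[]/eqP Eu.
- by exists x, y; split=> //; rewrite ?xy // Ev; case/orP: Ey => /eqP->.
- by exists y, x; rewrite xy orbT.
- by exists x, y; rewrite xy.
- by exists x, y; split=> //; rewrite ?xy // Eu; case/orP: Ex => /eqP->.
Qed.

Lemma adj_hard_graph (S : {set label}) x y :
  up (mem S) x y -> adj (hard_graph S) (f x) (f y).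
Proof.
move=> xy; have e2 : #|[set f x; f y]%SET| == 2%N.
  rewrite cards2 (inj_eq f_inj); suff -> : x != y by [].
  by apply: contraTneq xy => ->; apply/negP => /up_height; lia.
apply/existsP; exists (exist (fun e : {set 'I_n} => #|e| == 2%N) _ e2 : edge n); rewrite inE /= eqxx andbT.
by apply/existsP; exists x; apply/existsP; exists y; rewrite xy eqxx.
Qed.

Lemma adj_sub (G1 G2 : graph n) u v : G1 \subset G2 -> adj G1 u v -> adj G2 u v.
Proof.
move=> /fintype.subsetP sub /existsP[e /andP[eG uv]].
by apply/existsP; exists e; rewrite sub.
Qed.

Lemma adjC (G1 : graph n) u v : adj G1 u v = adj G1 v u.
Proof. by apply: eq_existsb => e; rewrite finset.setUC. Qed.

Lemma decode_sub (S : {set label}) (H : graph n) :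
  H \subset hard_graph S -> decode H \subset S.
Proof.
move=> sub; apply/fintype.subsetP => l; rewrite inE.
case/existsP=> x /existsP[y /and3P[jxy /eqP<- /(adj_sub sub)/adj_hard_graphP]].
case=> x' [y' [/f_inj<- /f_inj<- {x' y'}]].
have hxy : height y = (height x).+1.
  by apply: (@up_height predT); rewrite /up jxy orbT.
case/orP=> [/orP[/and4P[_ _ _ /eqP py]|/andP[]]//|/up_height]; last by lia.
by case/and4P: jxy => _; rewrite py.
Qed.

(** An undecoded label has no biclique edge in [H], so walks of [H] lift to walks avoiding that
    label. *)
Lemma lift_path (S : {set label}) (H : graph n) l x p :
  H \subset hard_graph S -> l \notin decode H -> path (adj H) (f x) p ->
  exists q, p = [seq f y | y <- q] /\
    path (fun y z => up (predC1 l) y z || up (predC1 l) z y) x q.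
Proof.
move=> sub nl; have avoid y z : adj H (f y) (f z) -> up (mem S) y z -> up (predC1 l) y z.
  move=> Hyz /orP[yz|/andP[yz _]]; first by rewrite /up yz.
  rewrite /up yz orbC /=; apply/orP; left; apply: contraNN nl => /eqP<-.
  by rewrite inE; apply/existsP; exists y; apply/existsP; exists z; rewrite yz eqxx.
elim: p x => [|v p IH] x /=; first by exists [::].
case/andP=> xv; have [y [z [/f_inj<- {y} vz]]] := adj_hard_graphP (adj_sub sub xv).
move: xv; rewrite {}vz => xz up_xz /IH[q [-> hq]]; exists (z :: q); split => //=.
rewrite hq andbT; case/orP: up_xz => [/(avoid _ _ xz)-> //|/avoid->]; first exact: orbT.
by rewrite adjC.
Qed.

Hypothesis alpha_convex : forall (t : T) ts, size ts = k.+1 ->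
  \sum_(u <- ts) alpha u = alpha t *+ k.+1 -> all (pred1 t) ts.

Lemma decode_spanner (R : realType) (S : {set label}) (H : graph n) :
  is_spanner R k (hard_graph S) H -> decode H = S.
Proof.
case=> sub dist_H; apply/eqP; rewrite finset.eqEsubset decode_sub //=.
apply/fintype.subsetP => l lS; apply/contraT => nl; case: l lS nl => [[v0 a] b] lS nl.
pose r := route v0 a b; pose len := route_length.
have dist_G : (dist R (hard_graph S) (f (r 0%N)) (f (r len)) <= len%:R%:E)%E.
  apply: ereal_inf_lbound; exists [seq f (r i) | i <- iota 1 len]; last first.
    by rewrite size_map size_iota.
  have /(_ 0%N len (leqnn len)) : forall i m, (i + m <= len)%N ->
      path (adj (hard_graph S)) (f (r i)) [seq f (r i) | i <- iota i.+1 m] /\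
      last (f (r i)) [seq f (r i) | i <- iota i.+1 m] = f (r (i + m)%N).
    move=> i m; elim: m i => [|m IH] i him /=; first by rewrite addn0.
    have [|-> ->] := IH i.+1; first by rewrite addSnnS.
    by rewrite adj_hard_graph ?addSnnS //; apply: route_up => //; lia.
  by case=> hp hl; apply/andP; split; last exact/eqP.
(* An infimum strictly below [(len + k).+1] yields an actual path, of length at most [len + k]. *)
have /ereal_inf_lt[_ [p /andP[hp /eqP hl] <-]] :
    (dist R H (f (r 0%N)) (f (r len)) < (len + k).+1%:R%:E)%E.
  apply: le_lt_trans (dist_H _ _) _; apply: le_lt_trans (leeD2r _ dist_G) _.
  by rewrite -EFinD lte_fin -natrD ltr_nat.
rewrite lte_fin ltr_nat ltnS leqNgt => /negP[].
have [q [Ep hq]] := lift_path sub nl hp.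
rewrite Ep size_map; apply: (avoid_long_path alpha_convex hq).
by apply: f_inj; rewrite -last_map -Ep hl.
Qed.

End Embedding.
End LayeredGraph.

(** * Communication bounds *)

(** Each bit written splits [D] in two parts with one bit less to spend, and a leaf decodes to a
    single value. *)
Lemma card_decoded (A : finType) (s : nat) (X O : Type) (p : protocol s X O)
    (x : A -> 'I_s -> X) (dec : O -> A) (C : nat) (D : {set A}) :
  (forall d, d \in D -> (bits p (x d) <= C)%N) ->
  (#|[set d in D | dec (run p (x d)) == d]%SET| <= 2 ^ C)%N.
Proof.
elim: p C D => [z|i f q IH] C D /= hC.
  apply: (@leq_trans #|[set dec z]%SET|); last by rewrite cards1 expn_gt0.
  by apply/subset_leq_card/fintype.subsetP => d; rewrite !inE eq_sym => /andP[].
case: C hC => [|C] hC.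
  by rewrite eq_card0 // => d; rewrite !inE; apply/negP => /andP[/hC].
pose D_ c := [set d in D | f (x d i) == c]%SET.
have hD c : (#|[set d in D_ c | dec (run (q c) (x d)) == d]%SET| <= 2 ^ C)%N.
  by apply: IH => d; rewrite inE => /andP[dD /eqP<-]; exact: hC dD.
rewrite expnS mul2n -addnn.
apply: leq_trans (leq_add (hD true) (hD false)); apply: leq_trans (leq_card_setU _ _).
apply/subset_leq_card/fintype.subsetP => d; rewrite !inE => /andP[-> ].
by case: (f (x d i)) => ->.
Qed.

Lemma bits_le_cost (R : realType) (s : nat) (X : finType) (O : Type)
    (P : rprotocol R s X O) (w : 'I_(coins P)) (x : {ffun 'I_s -> X}) :
  (bits (strategy w) x <= cost P)%N.
Proof.
by rewrite /cost (bigop.bigmax_sup w) // (bigop.bigmax_sup x).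
Qed.

Lemma success_indicator (R : realType) (s : nat) (X O : Type)
    (P : rprotocol R s X O) (x : 'I_s -> X) (good : O -> Prop) :
  success P x good =
  \sum_(w < coins P) prob w * `[< good (run (strategy w) x) >]%:R.
Proof.
rewrite /success big_mkcond; apply: eq_bigr => w _.
by case: asboolP => _; rewrite ?mulr1 ?mulr0.
Qed.

(** Averaging over inputs: each coin is right on at most [2 ^ cost P] of the [2 ^ M] inputs. If
    [cost P < M] this is at most half of them, less than the required 2/3. *)
Lemma fooling_cost (R : realType) (s : nat) (X : finType) (O : Type)
    (problem : ('I_s -> X) -> O -> Prop) (P : rprotocol R s X O)
    (A : finType) (x : A -> {ffun 'I_s -> X}) (dec : O -> A) (M : nat) :
  solves problem P -> (forall d o, problem (x d) o -> dec o = d) ->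
  #|A| = (2 ^ M)%N -> (M <= cost P)%N.
Proof.
move=> solP decP cardA; rewrite leqNgt; apply/negP => lt_cost.
have lower : 2 / 3 * (2 ^ M)%:R <= \sum_(d : A) success P (x d) (problem (x d)).
  rewrite -cardA mulr_natr -sumr_const; apply: ler_sum => d _; exact: solP.
have upper : \sum_(d : A) success P (x d) (problem (x d)) <= (2 ^ cost P)%:R :> R.
  under eq_bigr do rewrite success_indicator.
  rewrite exchange_big /= -[leRHS]mul1r -[X in _ <= X * _](prob_sum1 P) mulr_suml.
  apply: ler_sum => w _; rewrite -mulr_sumr; apply: ler_wpM2l; rewrite ?prob_ge0 //.
  rewrite -natr_sum ler_nat.
  apply: leq_trans (@card_decoded A s X O (strategy w) (fun d => x d) dec
    (cost P) [set: A]%SET _); last by move=> d _; exact: bits_le_cost.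
  rewrite -sum1_card [leqRHS]big_mkcond; apply: leq_sum => d _ /=; rewrite !inE /=.
  by case: asboolP => // /decP->; rewrite eqxx.
have : (2 * 2 ^ cost P <= 2 ^ M)%N by rewrite -expnS leq_exp2l.
rewrite -(ler_nat R) natrM; have := le_trans lower upper.
have : 0 < (2 ^ cost P)%:R :> R by rewrite ltr0n expn_gt0.
move: ((2 ^ M)%:R : R) ((2 ^ cost P)%:R : R) => a b; clear; lra.
Qed.

(** * Sites that must speak *)

Fixpoint speakers (s : nat) (X O : Type) (p : protocol s X O) (x : 'I_s -> X) :
    seq 'I_s :=
  if p is Write i f q then i :: speakers (q (f (x i))) x else [::].

Lemma size_speakers (s : nat) (X O : Type) (p : protocol s X O) x :
  size (speakers p x) = bits p x.
Proof. by elim: p => //= i f q ->. Qed.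

Lemma run_silent (s : nat) (X O : Type) (p : protocol s X O) (x y : 'I_s -> X) i :
  (forall j, j != i -> x j = y j) -> i \notin speakers p x -> run p x = run p y.
Proof.
move=> xy; elim: p => //= j f q IH; rewrite inE negb_or eq_sym => /andP[ji].
by rewrite -(xy j ji); exact: IH.
Qed.

(** The successes on [x] and [y i] add up to at least 4/3, but a coin leaving [i] silent gives the
    same output on both and succeeds on at most one. So [i] speaks with probability at least 1/3;
    summing over [i] bounds the expected number of speakers. *)
Lemma sites_le_cost (R : realType) (s : nat) (X : finType) (O : Type)
    (problem : ('I_s -> X) -> O -> Prop) (P : rprotocol R s X O)
    (x : {ffun 'I_s -> X}) (y : 'I_s -> {ffun 'I_s -> X}) :
  solves problem P -> (forall i j, j != i -> x j = y i j) ->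
  (forall i o, problem x o -> ~ problem (y i) o) -> (s <= 3 * cost P)%N.
Proof.
move=> solP xy disj.
have speak i : 1 / 3 <= \sum_(w < coins P) prob w * (i \in speakers (strategy w) x)%:R.
  have : success P x (problem x) + success P (y i) (problem (y i)) <=
      \sum_(w < coins P) prob w * (i \in speakers (strategy w) x)%:R + 1.
    rewrite !success_indicator -[X in _ <= _ + X](prob_sum1 P) -!big_split; apply: ler_sum => w _ /=.
    rewrite -mulrDr -[X in _ <= _ + X]mulr1 -mulrDr.
    apply: ler_wpM2l; rewrite ?prob_ge0 // -natrD natr1 ler_nat.
    have [_|silent] := boolP (i \in _); first by do 2 case: `[< _ >].
    rewrite (run_silent (xy i) silent); case: asboolP => [gx|_]; last by case: `[< _ >].
    by case: asboolP => // gy; case: (disj i _ gx gy).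
  have := solP x; have := solP (y i); lra.
have : \sum_(i < s) (1 / 3 : R) <= (cost P)%:R.
  apply: le_trans (ler_sum _ (fun i _ => speak i)) _.
  rewrite exchange_big /= -[leRHS]mul1r -[X in _ <= X * _](prob_sum1 P) mulr_suml.
  apply: ler_sum => w _; rewrite -mulr_sumr; apply: ler_wpM2l;
    rewrite ?prob_ge0 // -natr_sum ler_nat.
  apply: leq_trans _ (bits_le_cost w x); rewrite -size_speakers.
  apply: leq_trans _ (fintype.card_size (speakers (strategy w) x)).
  rewrite -sum1_card [leqRHS]big_mkcond.
  by apply: leq_sum => i _; case: (i \in _).
rewrite sumr_const card_ord -mulr_natl -(ler_nat R) natrM; lra.
Qed.

Lemma comm_complexity_ge (R : realType) (s : nat) (X : finType) (O : Type)
    (problem : ('I_s -> X) -> O -> Prop) (c : R) :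
  (forall P : rprotocol R s X O, solves problem P -> c <= (cost P)%:R) ->
  (c%:E <= comm_complexity R problem)%E.
Proof.
by move=> h; apply: le_ereal_inf_tmp => _ [P /h hP <-]; rewrite lee_fin.
Qed.

(** No finite surplus lets the empty graph span a single edge: its ends would be at distance
    [+oo]. *)
Lemma spanner_cost_sites (R : realType) (k n s : nat)
    (P : rprotocol R s (graph n) (graph n)) :
  (1 < n)%N -> solves (@spanner_problem R k n s) P -> (s <= 3 * cost P)%N.
Proof.
case: n P => [|[|n]] // P _ solP.
have e2 : #|[set ord0; ord_max : 'I_n.+2]%SET| == 2%N by rewrite cards2.
pose e : edge n.+2 := exist (fun e : {set 'I_n.+2} => #|e| == 2%N) _ e2.
pose x : {ffun 'I_s -> graph n.+2} := [ffun=> finset.set0].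
pose y i : {ffun 'I_s -> graph n.+2} :=
  [ffun j => if j == i then finset.set1 e else finset.set0].
apply: (@sites_le_cost _ _ _ _ _ P x y) => //.
  by move=> i j /negPf ji; rewrite !ffunE ji.
move=> i H [Hsub _] [_ Hdist].
have H0 : H = finset.set0.
  apply/eqP; rewrite -finset.subset0; apply: fintype.subset_trans Hsub _.
  by apply/bigcupsP => j _; rewrite ffunE.
have := Hdist ord0 ord_max; rewrite leNgt => /negP; apply.
have -> : (dist R H ord0 ord_max = +oo)%E.
  rewrite /dist (_ : [set _ | _ in _] = set0) ?ereal_inf0 //.
  apply/seteqP; split => // y0 [p /andP[hp hlast] _]; case: p hp hlast => [|u p] //=.
  by rewrite H0 => /andP[/existsP[e']]; rewrite inE.
apply: (@le_lt_trans _ _ (1%:E + k%:R%:E)%E); last by rewrite -EFinD ltry.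
apply: leeD2r; apply: ereal_inf_lbound; exists [:: ord_max] => //=; rewrite eqxx !andbT.
apply/existsP; exists e; rewrite eqxx andbT; apply/bigcupP; exists i => //.
by rewrite ffunE eqxx inE.
Qed.

(** * The paraboloid *)

(* Makes products of finite abelian groups instances of finZmodType. *)
HB.saturate prod.

Section Paraboloid.
Variables (k r D : nat).

(* The moduli exceed every sum of k+1 entries, so sums can be compared in nat. *)
Definition coord_bound : nat := (k.+1 * D).+2.
Definition norm_bound : nat := (k.+1 * (r * D ^ 2)).+2.

Definition direction : finType := {ffun 'I_r -> 'I_D.+1}.
Definition ambient : finZmodType := ('rV['Z_coord_bound]_r * 'Z_norm_bound)%type.

Definition sqnorm (t : direction) : nat := (\sum_i t i ^ 2)%N.

Definition paraboloid (t : direction) : ambient :=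
  (\row_i (t i : nat)%:R, (sqnorm t)%:R).

Lemma natr_Zp_inj (p a b : nat) :
  (1 < p)%N -> (a < p)%N -> (b < p)%N -> a%:R = b%:R :> 'Z_p -> a = b.
Proof.
by move=> p1 ap bp /(congr1 val); rewrite /= !val_Zp_nat // !modn_small.
Qed.

Lemma sum_seq_leq (I : Type) (s : seq I) (F : I -> nat) (c : nat) :
  (forall x, F x <= c)%N -> (\sum_(x <- s) F x <= size s * c)%N.
Proof.
by move=> Fc; elim: s => [|x s IH]; rewrite ?big_nil // big_cons mulSn leq_add.
Qed.

Lemma sqnorm_le t : (sqnorm t <= r * D ^ 2)%N.
Proof.
rewrite -[X in (_ <= X * _)%N](card_ord r) -sum_nat_const; apply: leq_sum => i _.
by rewrite leq_exp2r // -ltnS.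
Qed.

(** Once both sums are read in [nat], the sum of |u - t|^2 equals that of |u|^2 - |t|^2 minus 2 t.(u
    - t), which is zero. *)
Lemma paraboloid_convex (t : direction) ts : size ts = k.+1 ->
  \sum_(u <- ts) paraboloid u = paraboloid t *+ k.+1 -> all (pred1 t) ts.
Proof.
move=> size_ts.
have -> : paraboloid t *+ k.+1 = \sum_(u <- ts) paraboloid t.
  by rewrite big_const_seq count_predT size_ts iter_addr addr0.
have fstE (F : direction -> ambient) : (\sum_(u <- ts) F u).1 = \sum_(u <- ts) (F u).1.
  exact: (big_morph fst).
have sndE (F : direction -> ambient) : (\sum_(u <- ts) F u).2 = \sum_(u <- ts) (F u).2.
  exact: (big_morph snd).
move=> sumE.
have coordE i : (\sum_(u <- ts) u i = \sum_(u <- ts) t i)%N.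
  have := congr1 (fun x : ambient => x.1 ord0 i) sumE; rewrite !fstE !summxE.
  have entry u : (paraboloid u).1 ord0 i = (u i)%:R by rewrite mxE.
  rewrite (eq_bigr _ (fun u _ => entry u)) (eq_bigr _ (fun u _ => entry t)).
  rewrite -!natr_sum; apply: natr_Zp_inj => //;
  by rewrite ltnS leqW // -size_ts; apply: sum_seq_leq => u; rewrite -ltnS.
have normE : (\sum_(u <- ts) sqnorm u = \sum_(u <- ts) sqnorm t)%N.
  have := congr1 (fun x : ambient => x.2) sumE; rewrite !sndE -!natr_sum.
  apply: natr_Zp_inj => //;
  by rewrite ltnS leqW // -size_ts; apply: sum_seq_leq => u; exact: sqnorm_le.
(* Equality case of convexity: the variance of ts around t vanishes. *)
pose Z (n : nat) : int := n%:R.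
have /eqP : \sum_(u <- ts) \sum_i (Z (u i) - Z (t i)) ^+ 2 = 0.
  have -> : \sum_(u <- ts) \sum_i (Z (u i) - Z (t i)) ^+ 2 =
      \sum_(u <- ts) (Z (sqnorm u) - Z (sqnorm t)) -
      2 * \sum_i (Z (t i) * \sum_(u <- ts) (Z (u i) - Z (t i))).
    under [X in _ - 2 * X]eq_bigr do rewrite mulr_sumr.
    rewrite [X in _ - 2 * X]exchange_big mulr_sumr -sumrB /=; apply: eq_bigr => u _.
    rewrite /Z /sqnorm !natr_sum -sumrB mulr_sumr -sumrB; apply: eq_bigr => i _.
    by rewrite !natrX; ring.
  rewrite sumrB /Z -!natr_sum normE subrr sub0r big1 ?mulr0 ?oppr0 // => i _.
  by rewrite sumrB -!natr_sum coordE subrr mulr0.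
rewrite psumr_eq0 => [|u _]; last by apply: sumr_ge0 => i _; exact: sqr_ge0.
move=> /allP all0; apply/allP => u /all0 /=; rewrite psumr_eq0 => [|i _]; last exact: sqr_ge0.
move=> /allP u0; apply/eqP/ffunP => i; apply: val_inj.
have := u0 i (mem_index_enum i); rewrite /= sqrf_eq0 subr_eq0 /Z => /eqP.
by move/eqP; rewrite eqr_nat => /eqP.
Qed.

Lemma card_ambient : #|ambient| = (coord_bound ^ r * norm_bound)%N.
Proof. by rewrite card_prod card_mx mul1n !card_ord. Qed.

Lemma card_direction : #|direction| = (D.+1 ^ r)%N.
Proof. by rewrite card_ffun !card_ord. Qed.

End Paraboloid.

(** Every label set gives a member of the family, so the fooling set has one bit per label. *)
Lemma spanner_cost_labels (R : realType) (G : finZmodType) (T : finType)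
    (alpha : T -> G) (k n s : nat) (P : rprotocol R s (graph n) (graph n)) :
  (forall (t : T) ts, size ts = k.+1 ->
    \sum_(u <- ts) alpha u = alpha t *+ k.+1 -> all (pred1 t) ts) ->
  (#|{: vertex G T k}| <= n)%N -> (0 < s)%N ->
  solves (@spanner_problem R k n s) P -> (#|{: label G T}| <= cost P)%N.
Proof.
move=> convex le_n s_gt0 solP.
pose f (x : vertex G T k) : 'I_n := widen_ord le_n (enum_rank x).
have f_inj : injective f.
  by move=> x y /(congr1 val)/= /val_inj/enum_rank_inj.
pose x (S : {set label G T}) : {ffun 'I_s -> graph n} :=
  [ffun=> hard_graph alpha f S].
apply: (@fooling_cost _ _ _ _ _ P {set label G T} x (decode alpha f) _ solP).
  move=> S H; rewrite /spanner_problem.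
  have -> : (\bigcup_(i < s) x S i)%SET = hard_graph alpha f S.
    apply/eqP; rewrite finset.eqEsubset; apply/andP; split.
      by apply/bigcupsP => i _; rewrite ffunE.
    apply/fintype.subsetP => e eS; apply/bigcupP; exists (Ordinal s_gt0) => //.
    by rewrite ffunE.
  exact: decode_spanner.
by rewrite -cardsT -powersetT card_powerset cardsT.
Qed.

Lemma card_vertex (G : finZmodType) (T : finType) (k : nat) :
  #|{: vertex G T k}| = (k.+1.*2 * (#|G| * #|G|) * #|T| * k.+2)%N.
Proof. by rewrite !card_prod !card_ord. Qed.

Lemma card_label (G : finZmodType) (T : finType) :
  #|{: label G T}| = (#|G| * #|G| * #|T| * #|T|)%N.
Proof. by rewrite !card_prod. Qed.

(** With [E = D.+1], the ambient group has order about E^(r+2) and there are E^r directions: about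
    E^(2(r+2)+r) vertices against E^(2(r+2)+2r) labels. The ratio of exponents tends to 4/3 as [r]
    grows. *)
Lemma spanner_cost_power (R : realType) (k r : nat) : (1 < r)%N ->
  exists B : nat, (0 < B)%N /\
  forall (E n s : nat) (P : rprotocol R s (graph n) (graph n)),
    (0 < E)%N -> (B * E ^ (3 * r + 4) <= n)%N -> (0 < s)%N ->
    solves (@spanner_problem R k n s) P -> (E ^ (4 * r + 4) <= cost P)%N.
Proof.
move=> r1; pose m := k.+1.
(* Levels and chain positions give [m.*2] and [k.+2]; the squared factor compares the order of the
   group with E^(r+2). *)
exists (m.*2 * (m.+1 ^ r * (m * r + 2)) ^ 2 * k.+2)%N; split.
  by rewrite !(muln_gt0, expn_gt0, addn_gt0) /= ?orbT.
move=> [//|D] n s P _ le_n s_gt0 solP.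
have vertex_le : (#|{: vertex (ambient k r D) (direction r D) k}| <= n)%N.
  apply: leq_trans le_n; rewrite card_vertex card_ambient card_direction -/m.
  rewrite /coord_bound /norm_bound -/m.
  have coord : ((m * D).+2 ^ r <= m.+1 ^ r * D.+1 ^ r)%N.
    by rewrite -expnMn leq_exp2r ?(ltnW r1) // /m; nia.
  have norm : ((m * (r * D ^ 2)).+2 <= (m * r + 2) * D.+1 ^ 2)%N by nia.
  have := leq_mul coord norm; set a := (_ * _)%N => h.
  have := leq_mul (leqnn (m.*2 * k.+2)) (leq_mul (leq_mul h h) (leqnn (D.+1 ^ r))).
  rewrite (_ : 3 * r + 4 = r + r + r + 2 + 2)%N; last by lia.
  rewrite !expnD.
  move: a (m.+1 ^ r)%N (D.+1 ^ r)%N (m * r + 2)%N (D.+1 ^ 2)%N {h coord norm}.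
  move=> a y z w v; rewrite -[((y * w) ^ 2)%N]mulnn; move: m.*2 k.+2 => c d.
  by rewrite (_ : c * d * (a * a * z) = c * (a * a) * z * d)%N; [|ring];
     rewrite (_ : c * d * _ = c * (y * w * (y * w)) * d * (z * z * z * v * v))%N; [|ring].
apply: leq_trans (spanner_cost_labels (@paraboloid_convex k r D) vertex_le s_gt0 solP).
rewrite card_label card_ambient card_direction.
have coord : (D.+1 ^ r <= coord_bound k D ^ r)%N.
  by rewrite leq_exp2r ?(ltnW r1) // /coord_bound; nia.
have norm : (D.+1 ^ 2 <= norm_bound k r D)%N.
  have : (1 * (2 * D ^ 2) <= k.+1 * (r * D ^ 2))%N by rewrite leq_mul // leq_mul.
  by rewrite /norm_bound -!mulnn; have := leq_total D 1; nia.
have h := leq_mul coord norm.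
have := leq_mul (leq_mul (leq_mul h h) (leqnn (D.+1 ^ r))) (leqnn (D.+1 ^ r)).
by apply: leq_trans; rewrite -!expnD (_ : r + 2 + (r + 2) + r + r = 4 * r + 4)%N //; lia.
Qed.

(** * Asymptotics *)

(** The factor [2 ^ p] comes from maximality of [E] and E + 1 <= 2E. *)
Lemma largest_root (B p n : nat) : (0 < B)%N -> (0 < p)%N -> (B <= n)%N ->
  exists E : nat, [/\ (0 < E)%N, (B * E ^ p <= n)%N & (n < B * 2 ^ p * E ^ p)%N].
Proof.
move=> B0 p0 Bn.
have ex : exists E, (B * E ^ p <= n)%N by exists 1%N; rewrite exp1n muln1.
have ub E : (B * E ^ p <= n)%N -> (E <= n)%N.
  apply: leq_trans; apply: leq_trans (leq_pmull _ B0).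
  by case: E => // E; rewrite -{1}[E.+1]expn1 leq_pexp2l.
case: (ex_maxnP ex ub) => E BE maxE.
have E0 : (0 < E)%N by apply: maxE; rewrite exp1n muln1.
exists E; split => //; rewrite ltnNge; apply/negP => le_n.
have /maxE : (B * E.+1 ^ p <= n)%N.
  apply: leq_trans le_n; rewrite -mulnA leq_pmul2l // -expnMn leq_exp2r //.
  by rewrite mul2n -addnn -addn1 leq_add2l.
by rewrite ltnn.
Qed.

Lemma spanner_cost_powR (R : realType) (k : nat) (eps : R) : 0 < eps ->
  exists C : R, 0 < C /\ exists N : nat,
  forall (n s : nat) (P : rprotocol R s (graph n) (graph n)),
    (N <= n)%N -> (0 < s)%N -> solves (@spanner_problem R k n s) P ->
    n%:R `^ (4 / 3 - eps) <= C * (cost P)%:R.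
Proof.
move=> eps0; have [r r_gt r1] : exists2 r : nat, eps^-1 <= r%:R & (1 < r)%N.
  exists (Num.bound eps^-1).+2 => //.
  apply: (le_trans (ltW (archi_boundP _))); first by rewrite invr_ge0 ltW.
  by rewrite ler_nat; lia.
have [B [B0 costB]] := @spanner_cost_power R k r r1.
have [p pE] : exists p, p = (3 * r + 4)%N by eexists.
have [q qE] : exists q, q = (4 * r + 4)%N by eexists.
have [B' B'E] : exists B', B' = (B * 2 ^ p)%N by eexists.
have B'0 : (0 < B')%N by rewrite B'E muln_gt0 B0 expn_gt0.
have p_gt0 : (0 < p)%N by rewrite pE addn_gt0 orbT.
have p0 : 0 < p%:R :> R by rewrite ltr0n.
(* The constant [B'] gets raised to the power q/p, which is at most 2. *)
exists (B'%:R ^+ 2); split; first by rewrite exprn_gt0 // ltr0n.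
exists B => n s P Bn s0 solP.
have [E [E0 le_n lt_n]] := largest_root B0 p_gt0 Bn; rewrite -B'E in lt_n.
have n1 : 1 <= n%:R :> R by rewrite ler1n; exact: leq_trans Bn.
(* Indeed 4/3 - q/p = 4/(3p) < 1/r <= eps. *)
have exponent : 4 / 3 - eps <= q%:R / p%:R.
  rewrite ler_pdivlMr // pE qE (natrD _ (3 * r)) (natrD _ (4 * r)) !natrM.
  have er : 1 <= eps * r%:R by rewrite -ler_pdivrMl // mulr1.
  nra.
apply: (le_trans (ler_powR n1 exponent)).
apply: (@le_trans _ _ ((B'%:R * E%:R ^+ p) `^ (q%:R / p%:R))).
  apply: ge0_ler_powR; rewrite ?nnegrE ?divr_ge0 ?mulr_ge0 ?exprn_ge0 //.
  by rewrite -natrX -natrM ler_nat ltnW.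
rewrite powRM ?exprn_ge0 // -powR_mulrn // -powRrM mulrCA mulfV ?lt0r_neq0 // mulr1.
rewrite powR_mulrn //; apply: ler_pM; rewrite ?powR_ge0 ?exprn_ge0 //.
  rewrite -powR_mulrn //; apply: ler_powR; first by rewrite ler1n.
  by rewrite ler_pdivrMr // -natrM ler_nat pE qE; lia.
by rewrite -natrX ler_nat; rewrite qE; apply: costB E0 _ s0 solP; rewrite -pE.
Qed.

Lemma ln_le_powR (R : realType) (x e : R) : 0 < x -> 0 < e -> ln x <= e^-1 * x `^ e.
Proof.
move=> x0 e0; rewrite ler_pdivlMl // -ln_powR.
exact/ltW/ln_sublinear/powR_gt0.
Qed.

(** The constant 12 = 3 + 9 must not depend on [eps], which will later vary with [n]; only the
    threshold [N] may. *)
Lemma spanner_cost_eps (R : realType) (k : nat) (eps : R) : 0 < eps ->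
  exists N : nat, forall n, (N <= n)%N ->
  forall (s : nat) (P : rprotocol R s (graph n) (graph n)),
    (0 < s)%N -> solves (@spanner_problem R k n s) P ->
    s%:R + n%:R `^ (4 / 3 - eps) * ln s%:R <= 12 * (cost P)%:R.
Proof.
move=> eps0; have eps2 : 0 < eps / 2 by rewrite divr_gt0.
have [C [C0 [N costN]]] := spanner_cost_powR k eps2.
have eps4 : 0 < eps / 4 by rewrite divr_gt0.
pose D : R := 8 / eps * C; have D0 : 0 < D by rewrite mulr_gt0 // divr_gt0.
pose N' := Num.bound (D `^ (eps / 4)^-1).
exists (N + N' + 2)%N => n Nn s P s0 solP.
have n1 : (1 < n)%N by lia.
have n0 : 0 < n%:R :> R by rewrite ltr0n; lia.
have s1 : 0 < s%:R :> R by rewrite ltr0n.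
have lns0 : 0 <= ln s%:R :> R by rewrite ln_ge0 // ler1n.
have sites : s%:R <= 3 * (cost P)%:R :> R.
  by rewrite -natrM ler_nat; exact: spanner_cost_sites solP.
suff : n%:R `^ (4 / 3 - eps) * ln s%:R <= 9 * (cost P)%:R :> R by lra.
have [sn|ns] := leqP (n ^ 2) s.
  apply: (@le_trans _ _ (3 * s%:R)); last by lra.
  have pow : n%:R `^ (4 / 3 - eps) <= s%:R `^ (2 / 3) :> R.
    apply: (@le_trans _ _ (n%:R `^ (4 / 3))).
      by apply: ler_powR; [rewrite ler1n; lia | lra].
    rewrite (_ : 4 / 3 = 2%:R * (2 / 3)); last by lra.
    rewrite powRrM powR_mulrn ?ler0n //; apply: ge0_ler_powR;
      rewrite ?nnegrE ?exprn_ge0 ?ler0n //.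
    by rewrite -natrX ler_nat.
  have log : ln s%:R <= 3 * s%:R `^ (1 / 3) :> R.
    have third0 : 0 < 1 / 3 :> R by rewrite divr_gt0.
    by have := ln_le_powR s1 third0; rewrite [(1 / 3)^-1]invf_div divr1.
  apply: le_trans (ler_pM (powR_ge0 _ _) lns0 pow log) _.
  rewrite mulrCA -powRD; last by rewrite gt_eqF ?implybT.
  by rewrite (_ : 2 / 3 + 1 / 3 = 1) ?powRr1 ?ler0n //; lra.
apply: (@le_trans _ _ (cost P)%:R); last by have : 0 <= (cost P)%:R :> R by []; lra.
have log : ln s%:R <= 8 / eps * n%:R `^ (eps / 4) :> R.
  apply: (@le_trans _ _ (ln (n%:R ^+ 2))).
    by rewrite ler_ln ?posrE ?exprn_gt0 // -natrX ler_nat ltnW.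
  rewrite -powR_mulrn ?ler0n // ln_powR.
  have := ln_le_powR n0 eps4; rewrite invf_div => h.
  have -> : 8 / eps * n%:R `^ (eps / 4) = 2 * (4 / eps * n%:R `^ (eps / 4)).
    by rewrite mulrA; congr (_ * _); field; rewrite gt_eqF.
  by rewrite ler_pM2l.
have large : D <= n%:R `^ (eps / 4).
  have -> : D = (D `^ (eps / 4)^-1) `^ (eps / 4).
    by rewrite -powRrM mulVf ?gt_eqF // powRr1 // ltW.
  apply: ge0_ler_powR; rewrite ?nnegrE ?powR_ge0 ?ler0n ?(ltW eps4) //.
  apply: (le_trans (ltW (archi_boundP _))); first exact: powR_ge0.
  by rewrite ler_nat -/N'; lia.
have main := costN n s P _ s0 solP.
have {}main : n%:R `^ (4 / 3 - eps / 2) <= C * (cost P)%:R by apply: main; lia.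
(* Half of [eps] was kept in reserve as two factors [X]: one pays for the logarithm, the other
   absorbs the constant [D]. *)
set X := n%:R `^ (eps / 4) in log large *.
have X0 : 0 < X by apply: powR_gt0.
have splitE : n%:R `^ (4 / 3 - eps / 2) = n%:R `^ (4 / 3 - eps) * X * X.
  have nz (r t : R) : (r + t == 0) ==> (n%:R != 0 :> R) by rewrite (gt_eqF n0) implybT.
  by rewrite /X -(powRD (nz _ _)) -(powRD (nz _ _)); congr (_ `^ _); lra.
rewrite splitE in main.
set Y := n%:R `^ (4 / 3 - eps) in main *; have Y0 : 0 <= Y by apply: powR_ge0.
apply: (@le_trans _ _ (Y * (8 / eps * X))); first by rewrite ler_wpM2l.
have e8 : 0 < 8 / eps by rewrite divr_gt0.
rewrite -(ler_pM2r X0).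
apply: (@le_trans _ _ (8 / eps * (C * (cost P)%:R))).
  rewrite (_ : _ * X = 8 / eps * (Y * X * X)); last by ring.
  by rewrite ler_pM2l.
rewrite mulrA -/D [leRHS]mulrC; exact: ler_wpM2r.
Qed.

(** Take for [g n] the largest index up to [n] whose threshold has been passed. *)
Lemma diagonal_choice (Q : nat -> nat -> Prop) :
  (forall i, exists N, forall n, (N <= n)%N -> Q i n) ->
  exists g : nat -> nat,
    (forall i, exists N, forall n, (N <= n)%N -> (i <= g n)%N) /\
    exists N, forall n, (N <= n)%N -> Q (g n) n.
Proof.
move=> /choice[N QN].
exists (fun n => (\max_(i < n.+1 | N i <= n) i)%N); split=> [i|].
  exists (i + N i)%N => n le_n; have lt_i : (i < n.+1)%N by lia.
  by apply: (bigop.bigmax_sup (Ordinal lt_i)) => //=; lia.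
(* From [N 0] on, index 0 qualifies, so the maximum is attained rather than being the default 0. *)
exists (N 0%N) => n le_n; apply: QN.
have ne : (0 < #|[pred i : 'I_n.+1 | N i <= n]|)%N by apply/card_gt0P; exists ord0.
by have [i Ni ->] := bigop.eq_bigmax_cond (fun i : 'I_n.+1 => i : nat) ne.
Qed.

Theorem theorem14 (R : realType) (k : nat) :
  exists o1 : nat -> R, o1 n @[n --> \oo] --> (0 : R) /\
  exists c : R, 0 < c /\
  exists N : nat, forall n s : nat, (N <= n)%N -> (0 < s)%N ->
    ((c * (s%:R + n%:R `^ (4 / 3 - o1 n) * ln (s%:R : R)))%:E
       <= spanner_complexity R k n s)%E.
Proof.
have [g [g_unbounded [N costN]]] := diagonal_choice
  (fun i => @spanner_cost_eps R k i.+1%:R^-1 (ltac:(by rewrite invr_gt0 ltr0n))).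
(* The exponent loss at [n] is the [eps] of index [g n]; it vanishes because [g] tends to
   infinity. *)
exists (fun n => (g n).+1%:R^-1); split.
  apply/cvgrPdist_le => e e0; have [M gM] := g_unbounded (Num.bound e^-1).
  exists M => // n /= /gM le_g; rewrite sub0r normrN ger0_norm ?invr_ge0 //.
  rewrite invf_ple ?posrE //; apply: (le_trans (ltW (archi_boundP _))).
    by rewrite invr_ge0 ltW.
  by rewrite ler_nat leqW.
exists 12^-1; split; first by rewrite invr_gt0.
exists N => n s le_n s0; apply: comm_complexity_ge => P solP.
by rewrite ler_pdivrMl //; exact: (costN n le_n s P s0 solP).
Qed.
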